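(* Let $f\colon X\to Y$ be a large scale uniform function between metric spaces. Then $$\operatorname{asdim}(X)\leq \operatorname{asdim}(f)+\operatorname{asdim}(Y).$$
   Context: For a metric space $X$ and $n\ge 0$: $\operatorname{asdim}(X)\le n$ means that for every $r>0$ there are $D<\infty$ and families $\mathcal U_1,\dots,\mathcal U_{n+1}$ of subsets of $X$ such that $\bigcup_i\mathcal U_i$ covers $X$, each $\mathcal U_i$ is $r$-disjoint (i.e. $d(a,b)\ge r$ whenever $a,b$ lie in different members of $\mathcal U_i$), and every member of every $\mathcal U_i$ has diameter at most $D$. $\operatorname{asdim}(X)$ is the least such $n$ ($\infty$ if none exists). A function $f\colon X\to Y$ is large scale uniform if there is $c_f\colon\mathbb R_+\to\mathbb R_+$ with $d_X(x,y)\le r\Rightarrow d_Y(f(x),f(y))\le c_f(r)$. The asymptotic dimension of a function $f\colon X\to Y$ is $\operatorname{asdim}(f)=\sup\{\operatorname{asdim}(A): A\subset X,\ \operatorname{asdim}(f(A))=0\}$ (with the metrics restricted from $X$ and $Y$). *)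

(* Defs.v *)
From Stdlib Require Import Reals ClassicalEpsilon.
Open Scope R_scope.

Record MetricSpace := {
  carrier :> Type;
  dist : carrier -> carrier -> R;
  dist_refl : forall x, dist x x = 0;
  dist_eq0 : forall x y, dist x y = 0 -> x = y;
  dist_sym : forall x y, dist x y = dist y x;
  dist_tri : forall x y z, dist x z <= dist x y + dist y z
}.

Arguments dist {m}.

Inductive enat := Fin (n : nat) | Inf.

Definition ele (a b : enat) : Prop :=
  match a, b with
  | _, Inf => True
  | Fin m, Fin n => (m <= n)%nat
  | Inf, Fin _ => False
  end.

Definition eadd (a b : enat) : enat :=
  match a, b with
  | Fin m, Fin n => Fin (m + n)
  | _, _ => Inf
  end.

Definition asdim_le {X : MetricSpace} (A : X -> Prop) (n : nat) : Prop :=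
  forall r : R, 0 < r ->
  exists (D : R) (U : nat -> (X -> Prop) -> Prop),
    (forall i V, (i <= n)%nat -> U i V -> forall x, V x -> A x) /\
    (forall x, A x -> exists i V, (i <= n)%nat /\ U i V /\ V x) /\
    (forall i V W, (i <= n)%nat -> U i V -> U i W -> V <> W ->
       forall a b, V a -> W b -> r <= dist a b) /\
    (forall i V, (i <= n)%nat -> U i V -> forall a b, V a -> V b -> dist a b <= D).

Definition is_asdim {X : MetricSpace} (A : X -> Prop) (e : enat) : Prop :=
  match e with
  | Fin n => asdim_le A n /\ forall m, asdim_le A m -> (n <= m)%nat
  | Inf => forall m, ~ asdim_le A m
  end.

Definition asdim_sub {X : MetricSpace} (A : X -> Prop) : enat :=
  epsilon (inhabits Inf) (is_asdim A).

Definition asdim (X : MetricSpace) : enat := asdim_sub (fun _ : X => True).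

Definition is_esup (S : enat -> Prop) (e : enat) : Prop :=
  (forall a, S a -> ele a e) /\ (forall b, (forall a, S a -> ele a b) -> ele e b).

Definition esup (S : enat -> Prop) : enat := epsilon (inhabits Inf) (is_esup S).

Definition image {X Y : Type} (f : X -> Y) (A : X -> Prop) : Y -> Prop :=
  fun y => exists x, A x /\ f x = y.

Definition asdim_fun {X Y : MetricSpace} (f : X -> Y) : enat :=
  esup (fun e => exists A : X -> Prop, asdim_sub (image f A) = Fin 0 /\ e = asdim_sub A).

Definition large_scale_uniform {X Y : MetricSpace} (f : X -> Y) : Prop :=
  exists c : R -> R, forall r, 0 <= r -> 0 <= c r /\
    forall x y : X, dist x y <= r -> dist (f x) (f y) <= c r.

(* Main.v *)
(** Replace "a family that is [r]-disjoint and [D]-bounded" by "a set whose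
    [r]-components have diameter at most [D]".  Write [m] for the dimension of
    [f] and [n] for that of [Y].

    A sequence of [R]-bounded sets escaping to infinity fast enough has a union
    of asymptotic dimension 0; hence the preimages of the [R]-bounded subsets
    of [Y] have dimension at most [m] uniformly.  Decompose [Y] into [n + 1]
    sets with bounded [(R + 1)]-components, cover the preimage of each component
    by [m + 1] sets, and let the scale used over each of the [n + 1] sets exceed
    the bound obtained over the previous ones.  This gives a single cover of [X]
    by [m + 1] sets with uniformly bounded [r]-components over all [R]-bounded
    subsets of [Y].

    Let [k = m + n + 1].  Kolmogorov's trick enlarges the cover of [X] to [k]
    sets [S i] that contain each point at least [n + 1] times, and a cover of [Y]
    to [k] sets [T i] that contain each point at least [m + 1] times.  By
    counting, the [k] sets of those [x] in [S i] with [f x] in [T i] cover [X]. *)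

From Stdlib Require Import Reals Lra Lia Classical ClassicalEpsilon.
From Stdlib Require Import FunctionalExtensionality PropExtensionality.
Require Import Defs.
Open Scope R_scope.

(** * Chains *)

Section Chains.

Context {X : MetricSpace}.
Implicit Types (r D : R) (A B : X -> Prop).

Inductive chain r A : X -> X -> Prop :=
| chain_refl x : A x -> chain r A x x
| chain_step x y z : chain r A x y -> A z -> dist y z < r -> chain r A x z.

Definition bounded_components r D A : Prop :=
  forall x y, chain r A x y -> dist x y <= D.

Lemma chain_left r A x y : chain r A x y -> A x.
Proof. induction 1; auto. Qed.

Lemma chain_right r A x y : chain r A x y -> A y.
Proof. destruct 1; auto. Qed.

Lemma chain_trans r A x y z : chain r A x y -> chain r A y z -> chain r A x z.
Proof.
  intros H1 H2; induction H2 as [y Ay|y z w Hyz IH Aw Hd]; auto.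
  now apply chain_step with z; [apply IH| |].
Qed.

Lemma chain_sym r A x y : chain r A x y -> chain r A y x.
Proof.
  induction 1 as [x Ax|x y z Hxy IH Az Hd].
  - now apply chain_refl.
  - apply chain_trans with y; auto.
    apply chain_step with z; [now apply chain_refl| |now rewrite dist_sym].
    now apply chain_right in Hxy.
Qed.

Lemma chain_mono r r' A B x y :
  r <= r' -> (forall z, A z -> B z) -> chain r A x y -> chain r' B x y.
Proof.
  intros Hr HAB; induction 1 as [x Ax|x y z Hxy IH Az Hd].
  - apply chain_refl; auto.
  - apply chain_step with y; auto; lra.
Qed.

(** A property preserved by short steps inside [A] holds along the whole chain. Keeping it in the
    conclusion lets a diameter bound known only for a smaller set be applied. *)
Lemma chain_invariant r A (P : X -> Prop) x y :
  (forall u v, A u -> A v -> P u -> dist u v < r -> P v) ->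
  P x -> chain r A x y -> chain r (fun z => A z /\ P z) x y.
Proof.
  intros Hstep HP; induction 1 as [x Ax|x y z Hxy IH Az Hd].
  - now apply chain_refl.
  - specialize (IH HP).
    apply chain_step with y; auto.
    destruct (chain_right _ _ _ _ IH); split; auto.
    now apply Hstep with y.
Qed.

(** Components become equal as predicates, so distinct ones are disjoint and a choice can be made
    per component. *)
Lemma chain_class_eq r A x y : chain r A x y -> chain r A x = chain r A y.
Proof.
  intros H; extensionality z; apply propositional_extensionality; split; intros H'.
  - apply chain_trans with x; auto using chain_sym.
  - now apply chain_trans with y.
Qed.

Lemma bounded_components_mono r r' D D' A B :
  r' <= r -> D <= D' -> (forall z, B z -> A z) ->
  bounded_components r D A -> bounded_components r' D' B.
Proof.
  intros Hr HD HBA HA x y Hxy; apply Rle_trans with D; auto.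
  apply HA; now apply chain_mono with r' B.
Qed.

(* An [r]-chain in [A \/ B] visits [B] along a [(D + 2 r)]-chain, since each of
   its excursions in [A] has diameter at most [D]. *)
Lemma bounded_components_union r D D' A B :
  0 < r -> 0 <= D -> 0 <= D' ->
  bounded_components r D A -> bounded_components (D + 2 * r) D' B ->
  bounded_components r (D' + 2 * D + 2 * r) (fun x => A x \/ B x).
Proof.
  intros Hr HD HD' HA HB x y Hxy.
  (* Either the chain has not met [B] yet, or [b0] and [b] are its first and latest points in [B],
     followed by at most one excursion in [A]. *)
  assert (Hinv : chain r A x y \/
    exists b0 b, dist x b0 <= D + r /\ chain (D + 2 * r) B b0 b /\
      (y = b \/ exists a, chain r A a y /\ dist b a < r)).
  { induction Hxy as [x Hx|x y z Hxy IH Hz Hd].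
    - destruct Hx as [Hx|Hx]; [left; now apply chain_refl|right].
      exists x, x; repeat split; [rewrite dist_refl; lra|now apply chain_refl|now left].
    - destruct IH as [IH|(b0 & b & H0 & Hb & IH)].
      + destruct Hz as [Hz|Hz]; [left; now apply chain_step with y|right].
        exists z, z; repeat split; [|now apply chain_refl|now left].
        pose proof (dist_tri X x y z); apply HA in IH; lra.
      + right; destruct Hz as [Hz|Hz].
        * exists b0, b; repeat split; auto; right.
          destruct IH as [->|(a & Ha & Hba)].
          -- exists z; split; auto; now apply chain_refl.
          -- exists a; split; auto; now apply chain_step with y.
        * exists b0, z; repeat split; auto.
          apply chain_step with b; auto.
          destruct IH as [->|(a & Ha & Hba)]; [lra|].
          apply HA in Ha.
          pose proof (dist_tri X b a z); pose proof (dist_tri X a y z); lra. }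
  destruct Hinv as [H|(b0 & b & H0 & Hb & H)].
  - apply HA in H; lra.
  - apply HB in Hb.
    pose proof (dist_tri X x b0 y); pose proof (dist_tri X b0 b y).
    destruct H as [->|(a & Ha & Hba)].
    + rewrite dist_refl in *; lra.
    + apply HA in Ha; pose proof (dist_tri X b a y); lra.
Qed.

Definition nbhd r A : X -> Prop := fun x => exists y, A y /\ dist x y < r.

Lemma nbhd_self r A x : 0 < r -> A x -> nbhd r A x.
Proof. intros Hr Hx; exists x; now rewrite dist_refl. Qed.

(** Replacing each point of the chain by a point of [A] within [r] turns steps below [r] into steps
    below [3 * r]. *)
Lemma bounded_components_nbhd r D A :
  bounded_components (3 * r) D A -> bounded_components r (D + 2 * r) (nbhd r A).
Proof.
  intros HA x y Hxy.
  assert (Hinv : exists a b, dist x a < r /\ dist y b < r /\ chain (3 * r) A a b).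
  { induction Hxy as [x (a & Ha & Hxa)|x y z Hxy (a & b & Hxa & Hyb & Hab) (c & Hc & Hzc) Hd].
    - exists a, a; repeat split; auto; now apply chain_refl.
    - exists a, c; repeat split; auto; apply chain_step with b; auto.
      pose proof (dist_tri X b y c); pose proof (dist_tri X y z c).
      rewrite (dist_sym X b y) in *; lra. }
  destruct Hinv as (a & b & Hxa & Hyb & Hab); apply HA in Hab.
  pose proof (dist_tri X x a y); pose proof (dist_tri X a b y).
  rewrite (dist_sym X b y) in *; lra.
Qed.

End Chains.

(** * Covers *)

Fixpoint count (P : nat -> Prop) (k : nat) : nat :=
  match k with
  | O => O
  | S k' => (count P k' + if excluded_middle_informative (P k') then 1 else 0)%nat
  end.

Lemma count_le P Q k :
  (forall i, (i < k)%nat -> P i -> Q i) -> (count P k <= count Q k)%nat.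
Proof.
  induction k as [|k IH]; simpl; intros H; auto.
  specialize (IH (fun i Hi => H i (Nat.lt_lt_succ_r _ _ Hi))).
  specialize (H k (Nat.lt_succ_diag_r k)).
  destruct (excluded_middle_informative (P k)), (excluded_middle_informative (Q k));
    lia || tauto.
Qed.

Lemma count_lt P Q k j :
  (forall i, (i < k)%nat -> P i -> Q i) -> (j < k)%nat -> Q j -> ~ P j ->
  (count P k < count Q k)%nat.
Proof.
  induction k as [|k IH]; simpl; intros H Hj HQ HP; [lia|].
  assert (H' : forall i, (i < k)%nat -> P i -> Q i) by (intros; apply H; auto).
  pose proof (count_le P Q k H').
  specialize (H k (Nat.lt_succ_diag_r k)).
  destruct (Nat.eq_dec j k) as [->|Hjk].
  - destruct (excluded_middle_informative (P k)), (excluded_middle_informative (Q k));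
      lia || tauto.
  - assert (count P k < count Q k)%nat by (apply IH; auto; lia).
    destruct (excluded_middle_informative (P k)), (excluded_middle_informative (Q k));
      lia || tauto.
Qed.

Lemma count_pos P k i : (i < k)%nat -> P i -> (1 <= count P k)%nat.
Proof.
  induction k as [|k IH]; simpl; intros Hi HP; [lia|].
  destruct (Nat.eq_dec i k) as [->|Hik].
  - destruct (excluded_middle_informative (P k)); [lia|tauto].
  - assert (1 <= count P k)%nat by (apply IH; auto; lia); lia.
Qed.

Lemma count_pos_inv P k : (1 <= count P k)%nat -> exists i, (i < k)%nat /\ P i.
Proof.
  induction k as [|k IH]; simpl; intros H; [lia|].
  destruct (excluded_middle_informative (P k)) as [HP|HP]; [exists k; auto|].
  destruct IH as (i & Hi & HPi); [lia|exists i; auto].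
Qed.

Lemma count_meet P Q k :
  (k < count P k + count Q k)%nat -> exists i, (i < k)%nat /\ P i /\ Q i.
Proof.
  induction k as [|k IH]; simpl; intros H; [lia|].
  destruct (classic (P k /\ Q k)) as [[HP HQ]|Hn]; [exists k; auto|].
  destruct IH as (i & Hi & HPQ); [|exists i; auto].
  destruct (excluded_middle_informative (P k)), (excluded_middle_informative (Q k));
    lia || tauto.
Qed.

Definition cover {X : MetricSpace} (A : X -> Prop) (n : nat) (r D : R) : Prop :=
  exists S : nat -> X -> Prop,
    (forall i, (i <= n)%nat -> bounded_components r D (S i)) /\
    (forall x, A x -> exists i, (i <= n)%nat /\ S i x).

Lemma cover_mono {X : MetricSpace} (A B : X -> Prop) n r D D' :
  D <= D' -> (forall x, B x -> A x) -> cover A n r D -> cover B n r D'.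
Proof.
  intros HD HBA (S & HS & Hcov); exists S; split; auto.
  intros i Hi; apply bounded_components_mono with r D (S i); auto; lra.
Qed.

(** An [r]-chain in the union of an [r]-disjoint family cannot change member. Conversely, the
    [r]-components of each [S i], cut down to [A], form such a family. *)
Lemma asdim_le_cover {X : MetricSpace} (A : X -> Prop) n :
  asdim_le A n <-> forall r, 0 < r -> exists D, cover A n r D.
Proof.
  split; intros H r Hr.
  - destruct (H r Hr) as (D & U & Hsub & Hcov & Hdisj & Hbd).
    exists D, (fun i x => exists V, U i V /\ V x); split.
    + intros i Hi x y Hxy.
      assert (exists V, U i V /\ V x /\ V y) as (V & HV & Vx & Vy);
        [|now apply (Hbd i V)].
      induction Hxy as [x (V & HV & Vx)|x y z Hxy (V & HV & Vx & Vy) (W & HW & Wz) Hd].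
      * exists V; auto.
      * exists V; repeat split; auto.
        destruct (classic (V = W)) as [->|HVW]; auto.
        pose proof (Hdisj i V W Hi HV HW HVW y z Vy Wz); lra.
    + intros x Ax; destruct (Hcov x Ax) as (i & V & Hi & HV & Vx).
      exists i; split; auto; exists V; auto.
  - destruct (H r Hr) as (D & S & HS & Hcov).
    set (T i := fun x => A x /\ S i x).
    exists D, (fun i V => exists x, T i x /\ V = chain r (T i) x); split; [|split; [|split]].
    + intros i V Hi (x & Hx & ->) y Hy; apply (chain_right _ _ _ _ Hy).
    + intros x Ax; destruct (Hcov x Ax) as (i & Hi & HSx).
      exists i, (chain r (T i) x); repeat split; auto.
      * exists x; repeat split; auto.
      * apply chain_refl; split; auto.
    + intros i V W Hi (x & Hx & ->) (y & Hy & ->) HVW a b Ha Hb.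
      apply Rnot_lt_le; intros Hab; apply HVW, chain_class_eq.
      apply chain_trans with b; [|now apply chain_sym].
      apply chain_step with a; auto; apply (chain_right _ _ _ _ Hb).
    + intros i V Hi (x & Hx & ->) a b Ha Hb.
      apply (HS i Hi); apply chain_mono with r (T i); [lra|now intros z []|].
      apply chain_trans with x; auto; now apply chain_sym.
Qed.

(* The components are only required to be bounded inside the sets of the class [F]. *)
Definition multicover {X : MetricSpace} (F : (X -> Prop) -> Prop)
    (k c : nat) (r D : R) : Prop :=
  exists S : nat -> X -> Prop,
    (forall i B, (i < k)%nat -> F B -> bounded_components r D (fun x => S i x /\ B x)) /\
    (forall x, (c <= count (fun i => S i x) k)%nat).

(* Kolmogorov's trick.  The new set [T] consists of the points that the
   [r]-neighbourhoods of the [S i] cover only [c] times; an [r]-chain in [T]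
   cannot leave a set [S i]. *)
Lemma multicover_step {X : MetricSpace} (F F' : (X -> Prop) -> Prop) k c r D :
  0 < r -> (1 <= c)%nat -> (forall B, F B -> F' (nbhd r B)) ->
  multicover F' k c (3 * r) D -> multicover F (k + 1) (c + 1) r (D + 2 * r).
Proof.
  intros Hr Hc HF (S & HS & Hcov).
  set (T := fun x => (count (fun i => nbhd r (S i) x) k <= c)%nat).
  exists (fun i => if Nat.ltb i k then nbhd r (S i) else T).
  rewrite Nat.add_1_r; split.
  - intros i B Hi HB; destruct (Nat.ltb_spec i k) as [Hik|Hik].
    + apply bounded_components_mono with r (D + 2 * r)
        (nbhd r (fun z => S i z /\ nbhd r B z)); try lra.
      * intros x [(y & Hy & Hxy) HB']; exists y; repeat split; auto.
        exists x; split; auto; now rewrite dist_sym.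
      * apply bounded_components_nbhd, HS; auto.
    + intros x y Hxy.
      destruct (count_pos_inv (fun j => S j x) k) as (j & Hj & Hjx).
      { specialize (Hcov x); lia. }
      apply (chain_invariant r _ (S j)) in Hxy; auto.
      * apply Rle_trans with D; [|lra].
        apply (HS j (nbhd r B)); auto.
        revert Hxy; apply chain_mono; [lra|].
        intros z [[_ Bz] Sz]; split; auto; now apply nbhd_self.
      (* If [v] left [S j], it would still lie within [r] of it, so the neighbourhoods would cover
         [v] more than [c] times, against [T v]. *)
      * intros u v [Tu _] [Tv _] Hu Huv; apply NNPP; intros Hv.
        assert (count (fun i => S i v) k < count (fun i => nbhd r (S i) v) k)%nat.
        { apply count_lt with j; auto.
          - intros; now apply nbhd_self.
          - exists u; split; auto; now rewrite dist_sym. }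
        specialize (Hcov v); unfold T in Tv; lia.
  - intros x; simpl; rewrite Nat.ltb_irrefl.
    assert (Heq : (count (fun i => nbhd r (S i) x) k <=
        count (fun i => (if Nat.ltb i k then nbhd r (S i) else T) x) k)%nat).
    { apply count_le; intros i Hi Hx; apply Nat.ltb_lt in Hi; now rewrite Hi. }
    assert (count (fun i => S i x) k <= count (fun i => nbhd r (S i) x) k)%nat
      by (apply count_le; intros; now apply nbhd_self).
    specialize (Hcov x).
    destruct (excluded_middle_informative (T x)) as [HT|HT]; unfold T in HT; lia.
Qed.

(** Each step adds one set and one unit of multiplicity, at the price of starting from the larger
    scale [3 * r]. *)
Lemma multicover_all_iter {X : MetricSpace} n j :
  asdim_le (fun _ : X => True) n ->
  forall r, 0 < r -> exists D,
    multicover (fun _ : X -> Prop => True) (n + 1 + j) (1 + j) r D.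
Proof.
  intros Hdim; induction j as [|j IH]; intros r Hr.
  - destruct (proj1 (asdim_le_cover _ n) Hdim r Hr) as (D & S & HS & Hcov).
    exists D, S; split.
    + intros i B Hi _; apply bounded_components_mono with r D (S i);
        try lra; [tauto|apply HS; lia].
    + intros x; destruct (Hcov x I) as (i & Hi & Hx).
      apply count_pos with i; auto; lia.
  - destruct (IH (3 * r)) as (D & HD); [lra|].
    exists (D + 2 * r).
    replace (n + 1 + S j)%nat with (n + 1 + j + 1)%nat by lia.
    replace (1 + S j)%nat with (1 + j + 1)%nat by lia.
    apply multicover_step with (fun _ => True); auto; lia.
Qed.

(** * Functions *)

Section Functions.

Context {X Y : MetricSpace} (f : X -> Y).

Definition preimage (B : Y -> Prop) : X -> Prop := fun x => B (f x).

Definition diam_le (B : Y -> Prop) (R : R) : Prop :=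
  forall y z, B y -> B z -> dist y z <= R.

Definition image_diam_le (R : R) (B : X -> Prop) : Prop :=
  forall x y, B x -> B y -> dist (f x) (f y) <= R.

(** * Preimages of uniformly bounded sets *)

(** At scale [s < INR N], every [B k] with [k > N] is farther than [s] from the other sets, while
    the sets up to index [N] lie in one ball around [y0]. *)
Lemma sparse_union_asdim (y0 : Y) (B : nat -> Y -> Prop) (t : nat -> R) R :
  0 <= R ->
  (forall k, diam_le (B k) R) ->
  (forall k y, B k y -> t k - R <= dist y0 y <= t k + R) ->
  (forall k, t k + INR (S k) + 2 * R < t (S k)) ->
  asdim_le (fun y => exists k, B k y) 0.
Proof.
  intros HR Hdiam Ht Hgrow.
  assert (Hmono : forall k l, (k <= l)%nat -> t k <= t l).
  { intros k l; induction 1 as [|l Hl IH]; [lra|].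
    specialize (Hgrow l); pose proof (pos_INR (S l)); lra. }
  assert (Hgap : forall k l y z, (k < l)%nat -> B k y -> B l z -> INR l < dist y z).
  { intros k [|l] y z Hkl Hy Hz; [lia|].
    apply Ht in Hy, Hz; specialize (Hgrow l).
    assert (t k <= t l) by (apply Hmono; lia).
    pose proof (dist_tri Y y0 y z); lra. }
  apply asdim_le_cover; intros s Hs.
  destruct (INR_unbounded s) as (N & HN).
  assert (Hsep : forall k l y z, (N < k)%nat \/ (N < l)%nat -> B k y -> B l z ->
            dist y z < s -> k = l).
  { intros k l y z Hkl Hy Hz Hd.
    destruct (Nat.lt_trichotomy k l) as [H|[H|H]]; auto; exfalso.
    - pose proof (Hgap k l y z H Hy Hz).
      assert (INR N <= INR l) by (apply le_INR; lia); lra.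
    - rewrite dist_sym in Hd; pose proof (Hgap l k z y H Hz Hy).
      assert (INR N <= INR k) by (apply le_INR; lia); lra. }
  exists (Rmax R (2 * (t N + R))), (fun _ y => exists k, B k y); split.
  2: intros y Hy; exists 0%nat; auto.
  intros _ _ x y Hxy; destruct (chain_left _ _ _ _ Hxy) as (k & Hk).
  destruct (Nat.le_gt_cases k N) as [HkN|HkN].
  - apply (chain_invariant s _ (fun y => exists k, (k <= N)%nat /\ B k y)) in Hxy.
    + apply chain_right in Hxy; destruct Hxy as [_ (l & HlN & Hl)].
      eapply Rle_trans; [|apply Rmax_r].
      apply Ht in Hk, Hl; pose proof (Hmono k N HkN); pose proof (Hmono l N HlN).
      pose proof (dist_tri Y x y0 y); rewrite (dist_sym Y x y0) in *; lra.
    + intros u v _ (l & Hl) (j & HjN & Hj) Hd.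
      destruct (Nat.le_gt_cases l N) as [HlN|HlN]; [exists l; auto|].
      exists j; split; auto.
      now rewrite (Hsep j l u v (or_intror HlN) Hj Hl Hd).
    + exists k; auto.
  - apply (chain_invariant s _ (B k)) in Hxy; auto.
    + apply chain_right in Hxy; destruct Hxy as [_ Hy].
      eapply Rle_trans; [|apply Rmax_l]; now apply (Hdiam k).
    + intros u v _ (l & Hl) Hu Hd.
      now rewrite (Hsep k l u v (or_introl HkN) Hu Hl Hd).
Qed.

Lemma asdim_le_subset (Z : MetricSpace) (A B : Z -> Prop) n :
  (forall z, B z -> A z) -> asdim_le A n -> asdim_le B n.
Proof.
  rewrite !asdim_le_cover; intros HBA HA r Hr; destruct (HA r Hr) as (D & HD).
  exists D; now apply cover_mono with A D; [lra| |].
Qed.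

Lemma bounded_asdim (B : Y -> Prop) R : diam_le B R -> asdim_le B 0.
Proof.
  intros HB; apply asdim_le_cover; intros r Hr; exists R, (fun _ => B); split.
  - intros _ _ x y Hxy; apply HB; [apply (chain_left _ _ _ _ Hxy)|apply (chain_right _ _ _ _ Hxy)].
  - intros x Hx; exists 0%nat; auto.
Qed.

(** If no [D] works for all [B], there are counterexamples to the bound [INR k] for every [k],
    arbitrarily far from [y0]. A sparse union of them has dimension 0, so its preimage has a cover
    with one bound, which contradicts large [k]. *)
Lemma preimage_uniform_cover m :
  (forall A, asdim_le (image f A) 0 -> asdim_le A m) ->
  forall r R, 0 < r -> 0 <= R ->
  exists D, forall B, diam_le B R -> cover (preimage B) m r D.
Proof.
  intros Hf r R Hr HR; apply NNPP; intros Hn.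
  assert (Hbad : forall D, exists B, diam_le B R /\ ~ cover (preimage B) m r D).
  { intros D; apply NNPP; intros H; apply Hn; exists D; intros B HB.
    apply NNPP; intros HB'; apply H; now exists B. }
  assert (Hpre : forall B, asdim_le B 0 -> asdim_le (preimage B) m).
  { intros B HB; apply Hf, asdim_le_subset with B; auto.
    intros y (x & Hx & <-); exact Hx. }
  assert (Hne : forall D B, ~ cover (preimage B) m r D -> exists b, B b).
  { intros D B HB; apply NNPP; intros H; apply HB.
    exists (fun _ _ => False); split.
    - intros i _ x y Hxy; now apply chain_left in Hxy.
    - intros x Hx; exfalso; apply H; now exists (f x). }
  destruct (Hbad 0) as (B0 & _ & HB0); apply Hne in HB0 as (y0 & _).
  assert (Hfar : forall (M : Rdefinitions.R) (k : nat), exists p : (Y -> Prop) * Y,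
    diam_le (fst p) R /\ fst p (snd p) /\ M < dist y0 (snd p) /\
    ~ cover (preimage (fst p)) m r (INR k)).
  { intros M k.
    (* Any set of diameter at most [R] meeting the ball of radius [M] lies in [ball], whose preimage
       is covered with some bound [D]. A set bad for a bound at least [D] must therefore lie beyond
       [M]. *)
    set (ball := fun y => dist y0 y <= M + R).
    assert (Hball : asdim_le ball 0).
    { apply bounded_asdim with (2 * (M + R)); intros y z Hy Hz; unfold ball in *.
      pose proof (dist_tri Y y y0 z); rewrite (dist_sym Y y y0) in *; lra. }
    destruct (proj1 (asdim_le_cover _ m) (Hpre _ Hball) r Hr) as (D & HD).
    destruct (Hbad (Rmax D (INR k))) as (B & HB & HnB).
    destruct (Hne _ _ HnB) as (b & Hb).
    exists (B, b); simpl; repeat split; auto.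
    - apply Rnot_le_lt; intros HbM; apply HnB.
      apply cover_mono with (preimage ball) D; auto using Rmax_l.
      intros x Hx; unfold preimage, ball in *.
      specialize (HB b (f x) Hb Hx); pose proof (dist_tri Y y0 b (f x)); lra.
    - intros HC; apply HnB; apply cover_mono with (preimage B) (INR k);
        auto using Rmax_r. }
  set (G := fun M k => epsilon (inhabits (fun _ : Y => True, y0))
    (fun p => diam_le (fst p) R /\ fst p (snd p) /\ M < dist y0 (snd p) /\
              ~ cover (preimage (fst p)) m r (INR k))).
  assert (HG : forall M k, diam_le (fst (G M k)) R /\ fst (G M k) (snd (G M k)) /\
      M < dist y0 (snd (G M k)) /\ ~ cover (preimage (fst (G M k))) m r (INR k)).
  { intros M k; apply epsilon_spec, Hfar. }
  (* The increment [INR (S k') + 2 * R] is the gap that [sparse_union_asdim] demands. *)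
  set (s := fix s k := match k with
    | O => G 0 O
    | S k' => G (dist y0 (snd (s k')) + INR (S k') + 2 * R) (S k')
    end).
  assert (Hs : forall k, diam_le (fst (s k)) R /\ fst (s k) (snd (s k)) /\
                 ~ cover (preimage (fst (s k))) m r (INR k)).
  { intros [|k]; simpl s;
      [destruct (HG 0 0%nat) as (? & ? & _ & ?)
      |destruct (HG (dist y0 (snd (s k)) + INR (S k) + 2 * R) (S k)) as (? & ? & _ & ?)];
      auto. }
  assert (Hunion : asdim_le (fun y => exists k, fst (s k) y) 0).
  { apply sparse_union_asdim with y0 (fun k => dist y0 (snd (s k))) R; auto.
    - intros k; apply Hs.
    - intros k y Hy; destruct (Hs k) as (Hd & Hb & _).
      pose proof (Hd _ _ Hb Hy); pose proof (dist_tri Y y0 (snd (s k)) y).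
      pose proof (dist_tri Y y0 y (snd (s k))); rewrite (dist_sym Y y) in *; lra.
    - intros k; apply (HG (dist y0 (snd (s k)) + INR (S k) + 2 * R) (S k)). }
  destruct (proj1 (asdim_le_cover _ m) (Hpre _ Hunion) r Hr) as (D & HD).
  destruct (INR_unbounded D) as (k & Hk).
  apply (Hs k); apply (cover_mono _ _ _ _ _ (INR k)) with (3 := HD); [lra|].
  intros x Hx; now exists k.
Qed.

(* The scale used over the stratum [T p] is larger than the bound [D] obtained
   over the previous strata, so that the union lemma applies. *)
Lemma strata_multicover m r R R' (T : nat -> Y -> Prop) :
  (forall A, asdim_le (image f A) 0 -> asdim_le A m) ->
  0 < r -> 0 <= R' ->
  forall p, (forall i, (i < p)%nat -> bounded_components (R + 1) R' (T i)) ->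
  exists D (S : nat -> X -> Prop), 0 <= D /\
    (forall j B, (j <= m)%nat -> image_diam_le R B ->
       bounded_components r D (fun x => S j x /\ B x)) /\
    (forall x i, (i < p)%nat -> T i (f x) -> exists j, (j <= m)%nat /\ S j x).
Proof.
  intros Hf Hr HR' p; induction p as [|p IH]; intros HT.
  - exists 0, (fun _ _ => False); split; [lra|split].
    + intros j B _ _ x y Hxy; now apply chain_left in Hxy.
    + intros; lia.
  - destruct IH as (D & S & HD & HS & Hcov); [auto|].
    destruct (preimage_uniform_cover m Hf (D + 2 * r) R') as (D' & HD'); [lra|lra|].
    set (Q := fun y => chain (R + 1) (T p) y).
    assert (HQ : forall y, exists U : nat -> X -> Prop,
      (forall j, (j <= m)%nat -> bounded_components (D + 2 * r) D' (U j)) /\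
      (forall x, preimage (Q y) x -> exists j, (j <= m)%nat /\ U j x)).
    { intros y; apply HD'; intros u v Hu Hv; apply (HT p); auto.
      apply chain_trans with y; auto; now apply chain_sym. }
    (* The choice must depend only on the component [Q y], not on [y]. *)
    set (G := fun K : Y -> Prop => epsilon (inhabits (fun (_ : nat) (_ : X) => True))
      (fun U => (forall j, (j <= m)%nat -> bounded_components (D + 2 * r) D' (U j)) /\
                (forall x, preimage K x -> exists j, (j <= m)%nat /\ U j x))).
    assert (HG : forall y,
      (forall j, (j <= m)%nat -> bounded_components (D + 2 * r) D' (G (Q y) j)) /\
      (forall x, preimage (Q y) x -> exists j, (j <= m)%nat /\ G (Q y) j x)).
    { intros y; apply (epsilon_spec _ _ (HQ y)). }
    set (D1 := Rmax D' 0).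
    assert (HD1 : D' <= D1 /\ 0 <= D1) by (split; [apply Rmax_l|apply Rmax_r]).
    exists (D1 + 2 * D + 2 * r),
      (fun j x => S j x \/ (T p (f x) /\ G (Q (f x)) j x)); split; [lra|split].
    + intros j B Hj HB.
      apply bounded_components_mono with r (D1 + 2 * D + 2 * r)
        (fun x => (S j x /\ B x) \/ ((T p (f x) /\ G (Q (f x)) j x) /\ B x));
        [lra|lra|tauto|].
      apply bounded_components_union; auto; try lra.
      intros x y Hxy; destruct (chain_left _ _ _ _ Hxy) as [[HTx _] HBx].
      apply Rle_trans with D'; [|lra].
      apply (proj1 (HG (f x)) j Hj).
      revert Hxy; apply chain_mono; [lra|].
      intros z [[HTz Hz] HBz].
      (* Images of points of [B] are at most [R < R + 1] apart, so those in [T p] share one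
         component, and a single chosen cover applies. *)
      replace (Q (f x)) with (Q (f z)); auto.
      apply chain_class_eq, chain_step with (f z); auto using chain_refl.
      pose proof (HB z x HBz HBx); lra.
    + intros x i Hi HTx.
      destruct (Nat.eq_dec i p) as [->|Hip].
      * destruct (proj2 (HG (f x)) x) as (j & Hj & Hx); [now apply chain_refl|].
        exists j; auto.
      * destruct (Hcov x i) as (j & Hj & Hx); auto; [lia|exists j; auto].
Qed.

(** * The dimension inequality *)

(** The strata give multiplicity one. Passing to an [r]-neighbourhood enlarges the diameter of the
    image by at most [2 * c r], so the induction varies [R] as well as [r]. *)
Lemma multicover_fun_iter m n j :
  large_scale_uniform f ->
  (forall A, asdim_le (image f A) 0 -> asdim_le A m) ->
  asdim_le (fun _ : Y => True) n ->
  forall r R, 0 < r -> 0 <= R ->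
  exists D, multicover (image_diam_le R) (m + 1 + j) (1 + j) r D.
Proof.
  intros (c & Hc) Hf HY; induction j as [|j IH]; intros r R Hr HR.
  - destruct (proj1 (asdim_le_cover _ n) HY (R + 1)) as (R' & T & HT & HTcov); [lra|].
    destruct (strata_multicover m r R (Rmax R' 0) T Hf Hr (Rmax_r _ _) (n + 1))
      as (D & S & _ & HS & Hcov).
    { intros i Hi; apply bounded_components_mono with (R + 1) R' (T i); auto;
        [lra|apply Rmax_l|apply HT; lia]. }
    exists D, S; split.
    + intros i B Hi; apply HS; lia.
    + intros x; destruct (HTcov (f x) I) as (i & Hi & Hx).
      destruct (Hcov x i) as (k & Hk & HSk); auto; [lia|].
      apply count_pos with k; auto; lia.
  - destruct (Hc r) as [Hcr Hcf]; [lra|].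
    destruct (IH (3 * r) (R + 2 * c r)) as (D & HD); [lra|lra|].
    exists (D + 2 * r).
    replace (m + 1 + S j)%nat with (m + 1 + j + 1)%nat by lia.
    replace (1 + S j)%nat with (1 + j + 1)%nat by lia.
    apply multicover_step with (image_diam_le (R + 2 * c r)); auto; [lia|].
    intros B HB x y (x' & Hx' & Hx) (y' & Hy' & Hy).
    pose proof (HB x' y' Hx' Hy').
    assert (dist (f x) (f x') <= c r) by (apply Hcf; lra).
    assert (dist (f y') (f y) <= c r) by (apply Hcf; rewrite dist_sym; lra).
    pose proof (dist_tri Y (f x) (f x') (f y)).
    pose proof (dist_tri Y (f x') (f y') (f y)); lra.
Qed.

Lemma asdim_le_hurewicz m n :
  large_scale_uniform f ->
  (forall A, asdim_le (image f A) 0 -> asdim_le A m) ->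
  asdim_le (fun _ : Y => True) n ->
  asdim_le (fun _ : X => True) (m + n).
Proof.
  intros Hlsu Hf HY; apply asdim_le_cover; intros r Hr.
  destruct (Hlsu) as (c & Hc).
  destruct (Hc r) as [Hcr Hcf]; [lra|].
  (* The [+ 1] makes image steps of length at most [c r] strictly shorter than the scale. *)
  destruct (multicover_all_iter n m HY (c r + 1)) as (R & T & HT & HTcov); [lra|].
  set (R1 := Rmax R 0).
  destruct (multicover_fun_iter m n n Hlsu Hf HY r R1 Hr (Rmax_r _ _))
    as (D & S & HS & HScov).
  exists D, (fun i x => S i x /\ T i (f x)); split.
  - intros i Hi x y Hxy.
    (* An [r]-chain stays over one component of [T i]. As that component has diameter at most [R1],
       [S i] has bounded components inside [B]. *)
    set (B := fun z => chain (c r + 1) (fun y => T i y /\ True) (f x) (f z)).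
    apply (HS i B); [lia| |].
    + intros u v Hu Hv; apply Rle_trans with R; [|apply Rmax_l].
      apply (HT i (fun _ => True)); [lia|auto|].
      apply chain_trans with (f x); auto; now apply chain_sym.
    + apply (chain_invariant r _ B) in Hxy.
      * revert Hxy; apply chain_mono; [lra|tauto].
      * intros u v _ [_ Hv] Hu Hd; apply chain_step with (f u); auto.
        assert (dist (f u) (f v) <= c r) by (apply Hcf; lra); lra.
      * apply chain_refl; split; auto; now apply chain_left in Hxy.
  - intros x _.
    specialize (HScov x); specialize (HTcov (f x)).
    replace (n + 1 + m)%nat with (m + n + 1)%nat in HTcov by lia.
    replace (m + 1 + n)%nat with (m + n + 1)%nat in HScov by lia.
    (* The multiplicities [1 + n] and [1 + m] add up to one more than the number of indices. *)
    destruct (count_meet (fun i => S i x) (fun i => T i (f x)) (m + n + 1))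
      as (i & Hi & HSi & HTi); [lia|].
    exists i; split; auto; lia.
Qed.

End Functions.

(** * Dimension as an extended natural number *)

Lemma least_nat (P : nat -> Prop) n :
  P n -> exists m, P m /\ forall k, P k -> (m <= k)%nat.
Proof.
  induction n as [n IH] using (well_founded_induction Nat.lt_wf_0); intros Hn.
  destruct (classic (exists k, (k < n)%nat /\ P k)) as [(k & Hk & HP)|H].
  - now apply (IH k).
  - exists n; split; auto; intros k Hk; apply Nat.nlt_ge; intros Hkn.
    apply H; now exists k.
Qed.

(** Either a least bound exists or no bound does, so the [epsilon] in [asdim_sub] meets its
    specification. *)
Lemma asdim_sub_spec {X : MetricSpace} (A : X -> Prop) : is_asdim A (asdim_sub A).
Proof.
  apply (epsilon_spec (inhabits Inf) (is_asdim A)).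
  destruct (classic (exists n, asdim_le A n)) as [(n & Hn)|H].
  - destruct (least_nat _ n Hn) as (m & Hm); now exists (Fin m).
  - exists Inf; intros n Hn; apply H; now exists n.
Qed.

(** The cover is padded with empty sets at the indices above [m]. *)
Lemma asdim_le_weaken {X : MetricSpace} (A : X -> Prop) m n :
  (m <= n)%nat -> asdim_le A m -> asdim_le A n.
Proof.
  rewrite !asdim_le_cover; intros Hmn H r Hr.
  destruct (H r Hr) as (D & S & HS & Hcov).
  exists D, (fun i x => (i <= m)%nat /\ S i x); split.
  - intros i Hi x y Hxy; destruct (chain_left _ _ _ _ Hxy) as [Him _].
    apply (HS i Him); revert Hxy; apply chain_mono; [lra|tauto].
  - intros x Hx; destruct (Hcov x Hx) as (i & Hi & HSi); exists i; split; auto; lia.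
Qed.

Lemma ele_asdim_sub {X : MetricSpace} (A : X -> Prop) n :
  ele (asdim_sub A) (Fin n) <-> asdim_le A n.
Proof.
  pose proof (asdim_sub_spec A) as H; destruct (asdim_sub A) as [m|]; simpl in *.
  - split; [intros; apply asdim_le_weaken with m; tauto|apply H].
  - split; [tauto|apply H].
Qed.

Lemma esup_spec S : is_esup S (esup S).
Proof.
  apply (epsilon_spec (inhabits Inf) (is_esup S)).
  destruct (classic (exists n, forall a, S a -> ele a (Fin n))) as [(n & Hn)|H].
  - destruct (least_nat (fun n => forall a, S a -> ele a (Fin n)) n Hn) as (m & Hm & Hmin).
    exists (Fin m); split; auto.
    intros [b|] Hb; simpl; auto.
  - exists Inf; split.
    + now intros [|] _.
    + intros [b|] Hb; simpl; auto; apply H; now exists b.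
Qed.

Theorem mainTheorem1 (X Y : MetricSpace) (f : X -> Y) :
  large_scale_uniform f ->
  ele (asdim X) (eadd (asdim_fun f) (asdim Y)).
Proof.
  intros Hlsu.
  destruct (asdim_fun f) as [m|] eqn:Hm; [|now destruct (asdim X)].
  destruct (asdim Y) as [n|] eqn:Hn; [|now destruct (asdim X)].
  apply ele_asdim_sub, asdim_le_hurewicz with f; auto.
  - intros A HA; apply ele_asdim_sub; rewrite <- Hm.
    apply esup_spec; exists A; split; auto.
    (* The supremum ranges over images of dimension exactly [Fin 0]; a dimension at most 0 is equal
       to it. *)
    apply ele_asdim_sub in HA.
    destruct (asdim_sub (image f A)) as [k|]; simpl in HA; [|tauto].
    f_equal; lia.
  - apply ele_asdim_sub; fold (asdim Y); rewrite Hn; simpl; lia.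
Qed.
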